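(* Consider a countable-state MDP $(\mathbb{X},\mathbb{A},A(\cdot),c,q)$ with transition probabilities $q$ (i.e. $\sum_{y\in\mathbb{X}}q(y|x,a)=1$ for all $x\in\mathbb{X}$, $a\in A(x)$) satisfying the Compactness Conditions. Suppose $c$ is bounded and there are a state $\ell\in\mathbb{X}$ and a constant $K^*<\infty$ with $\|\sum_{n=0}^\infty {}_\ell Q_\phi^n\|\le K^*$ for all $\phi\in\mathbb{F}$. Let $\mu:\mathbb{X}\to[1,\infty)$ satisfy $\mu\le K^*$ and $\mu(x)\ge 1+\sum_{y\in\mathbb{X}\setminus\{\ell\}}q(y|x,a)\mu(y)$ for all $x\in\mathbb{X}$, $a\in A(x)$, let $\bar\beta\in[\frac{K^*-1}{K^*},1)$, and let $\bar v_{\bar\beta}$ be the value function of the discounted MDP defined by the HV-AG transformation. Then: (i) the constant $w=\bar v_{\bar\beta}(\ell)$ and the function $h(x)=\mu(x)[\bar v_{\bar\beta}(x)-\bar v_{\bar\beta}(\ell)]$, $x\in\mathbb{X}$, satisfy the optimality equation $$w+h(x)=\min_{a\in A(x)}\Big[c(x,a)+\sum_{y\in\mathbb{X}}q(y|x,a)h(y)\Big],\quad x\in\mathbb{X},$$ and $\bar v_{\bar\beta}(\ell)$ is the optimal average cost for each initial state, i.e. $\inf_{\phi\in\mathbb{F}}w^\phi(x)=\bar v_{\bar\beta}(\ell)$ for all $x\in\mathbb{X}$; (ii) with these $w$ and $h$, let $A^*_{\mathrm{av}}(x):=\{a\in A(x): w+h(x)=c(x,a)+\sum_{y\in\mathbb{X}}q(y|x,a)h(y)\}$.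 There is a $\phi\in\mathbb{F}$ satisfying $\phi(x)\in A^*_{\mathrm{av}}(x)$ for all $x\in\mathbb{X}$, where $$A^*_{\mathrm{av}}(x)=\Big\{a\in A(x):\ \bar v_{\bar\beta}(x)=\bar c(x,a)+\bar\beta\sum_{y\in\bar{\mathbb{X}}}\bar p(y|x,a)\bar v_{\bar\beta}(y)\Big\},\quad x\in\mathbb{X},$$ and any such policy is average-cost optimal.
   Context: Countable-state MDP: $\mathbb{X}$ is a countable set (states); $\mathbb{A}$ is a Borel subset of a complete separable metric space; for each $x\in\mathbb{X}$, $A(x)$ is a nonempty Borel subset of $\mathbb{A}$ (available actions); the real-valued one-step cost $c(x,a)$ is Borel measurable in $a\in A(x)$ for each $x$; the transition rates $q(y|x,a)\ge 0$ are measurable in $a\in A(x)$ for all $x,y$ and satisfy $\sup_{x\in\mathbb{X},a\in A(x)}\sum_{y\in\mathbb{X}}q(y|x,a)<\infty$. Write $q(\mathbb{X}|x,a):=\sum_{y\in\mathbb{X}}q(y|x,a)$. A stationary policy is a map $\phi:\mathbb{X}\to\mathbb{A}$ with $\phi(x)\in A(x)$ for all $x$; $\mathbb{F}$ is the set of all of them. $Q_\phi$ is the matrix with entries $q(y|x,\phi(x))$; ${}_\ell Q_\phi$ is the matrix with entries $q(y|x,\phi(x))$ for $y\ne\ell$ and $0$ for $y=\ell$; ${}_\ell Q_\phi^n$ is its $n$-th power; $c_\phi(x):=c(x,\phi(x))$; a matrix $B$ acts by $Bu(x)=\sum_yB(x,y)u(y)$; $\|B\|:=\sup_x\sum_y|B(x,y)|$.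 Average cost: $w^\phi(x):=\limsup_{N\to\infty}\frac1N\sum_{n=0}^{N-1}Q_\phi^nc_\phi(x)$; $\phi_*\in\mathbb{F}$ is average-cost optimal if $w^{\phi_*}(x)=\inf_{\phi\in\mathbb{F}}w^\phi(x)$ for all $x\in\mathbb{X}$. Compactness Conditions: (i) $A(x)$ is compact for each $x$; (ii) $c(x,a)$ is lower semicontinuous in $a\in A(x)$ for each $x$; (iii) $q(y|x,a)$ is continuous in $a\in A(x)$ for all $x,y$; (iv) $q(\mathbb{X}|x,a)$ is continuous in $a\in A(x)$ for each $x$. HV-AG transformation (given $\ell,K^*,\mu,\bar\beta$ as in the claim; under the hypothesis on ${}_\ell Q_\phi$ such a $\mu$ exists): state space $\bar{\mathbb{X}}:=\mathbb{X}\cup\{\bar x\}$ with $\bar x\notin\mathbb{X}$, action space $\mathbb{A}\cup\{\bar a\}$, action sets $\bar A(x):=A(x)$ for $x\in\mathbb{X}$ and $\bar A(\bar x):=\{\bar a\}$; costs $\bar c(x,a):=\mu(x)^{-1}c(x,a)$ for $x\in\mathbb{X}$, $a\in A(x)$, and $\bar c(\bar x,\bar a):=0$; transition probabilities, for $x\in\mathbb{X}$, $a\in A(x)$: $\bar p(y|x,a):=\frac{1}{\bar\beta\mu(x)}q(y|x,a)\mu(y)$ for $y\in\mathbb{X}\setminus\{\ell\}$, $\bar p(\ell|x,a):=\frac{1}{\bar\beta\mu(x)}[\mu(x)-1-\sum_{y\in\mathbb{X}\setminus\{\ell\}}q(y|x,a)\mu(y)]$, $\bar p(\bar x|x,a):=1-\frac{1}{\bar\beta\mu(x)}[\mu(x)-1]$,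 and $\bar p(\bar x|\bar x,\bar a):=1$. (If $\bar\beta=0$, which forces $K^*=1$, all the numerators vanish and quotients $0/0$ are read as $0$.) Policies are extended by $\phi(\bar x):=\bar a$. With $\bar P_\phi(x,y):=\bar p(y|x,\phi(x))$ and $\bar c_\phi(x):=\bar c(x,\phi(x))$, $\bar v^\phi_{\bar\beta}(x):=\sum_{n=0}^\infty\bar\beta^n\bar P_\phi^n\bar c_\phi(x)$ (with $0^0=1$) and $\bar v_{\bar\beta}(x):=\inf_{\phi\in\mathbb{F}}\bar v^\phi_{\bar\beta}(x)$, $x\in\bar{\mathbb{X}}$. *)

(* Defs.v *)
From HB Require Import structures.
From mathcomp Require Import all_boot all_order all_algebra.
From mathcomp Require Import all_classical all_reals all_analysis.

Set Implicit Arguments.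
Unset Strict Implicit.
Unset Printing Implicit Defensive.

Import Order.TTheory GRing.Theory Num.Theory.
Import numFieldNormedType.Exports.

Local Open Scope classical_set_scope.
Local Open Scope ring_scope.

#[short(type="completeMetricType")]
HB.structure Definition CompleteMetric (R : numDomainType) :=
  {T of Complete T & Metric R T}.

Definition separable (T : topologicalType) : Prop :=
  exists2 D : set T, countable D & dense D.

Notation borelType T := (g_sigma_algebraType (@open T)).

(** Infinite matrices have extended real entries, so that all sums below are
    meaningful without side conditions. *)
Section InfiniteMatrices.
Context {R : realType} {X : choiceType}.
Local Open Scope ereal_scope.
Implicit Types (B C : X -> X -> \bar R) (u f : X -> \bar R).

(** [esum] is only meaningful for nonnegative families; a signed family is
    summed unconditionally, as positive part minus negative part. *)
Definition csum f : \bar R :=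
  esum [set: X] f^\+ - esum [set: X] f^\-.

Definition imx_id : X -> X -> \bar R := fun x y => ((x == y)%:R)%:E.

Definition imx_mul B C : X -> X -> \bar R :=
  fun x y => csum (fun z => B x z * C z y).

Definition imx_exp B (n : nat) : X -> X -> \bar R :=
  iter n (imx_mul B) imx_id.

Definition imx_act B u : X -> \bar R := fun x => csum (fun y => B x y * u y).

Definition imx_norm B : \bar R :=
  ereal_sup [set \esum_(y in [set: X]) `|B x y| | x in [set: X]].

Definition imx_geometric B : X -> X -> \bar R :=
  fun x y => \sum_(0 <= n <oo) imx_exp B n x y.

Definition imx_taboo (l : X) B : X -> X -> \bar R :=
  fun x y => if y == l then 0 else B x y.

End InfiniteMatrices.

(** [cost M x] and [rate M x] are total functions of the action; only their
    values on [actions M x] are ever constrained or used.  [rate M x a y] is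
    q(y|x,a). *)
Record mdp (R : realType) (X S : Type) := MDP {
  actions : X -> set S;
  cost : X -> S -> R;
  rate : X -> S -> X -> R
}.

Section Criteria.
Context {R : realType} {X : countType} {S : Type}.
Local Open Scope ereal_scope.
Implicit Types (M : mdp R X S) (phi : X -> S).

Definition total_rate M (x : X) (a : S) : \bar R :=
  \esum_(y in [set: X]) (rate M x a y)%:E.

Definition policy M phi : Prop := forall x, actions M x (phi x).

Definition rate_mx M phi : X -> X -> \bar R :=
  fun x y => (rate M x (phi x) y)%:E.

Definition cost_vec M phi : X -> \bar R := fun x => (cost M x (phi x))%:E.

Definition average_cost M phi (x : X) : \bar R :=
  limn_esup (fun N : nat => (N%:R^-1)%:E *
    \sum_(0 <= n < N) imx_act (imx_exp (rate_mx M phi) n) (cost_vec M phi) x).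

Definition optimal_average_cost M (x : X) : \bar R :=
  ereal_inf [set average_cost M phi x | phi in policy M].

Definition average_cost_optimal M phi : Prop :=
  policy M phi /\ forall x, average_cost M phi x = optimal_average_cost M x.

Definition discounted_cost M (b : R) phi (x : X) : \bar R :=
  \sum_(0 <= n <oo) (b ^+ n)%:E *
    imx_act (imx_exp (rate_mx M phi) n) (cost_vec M phi) x.

Definition transition_probabilities M : Prop :=
  forall x a, actions M x a -> total_rate M x a = 1.

Definition bounded_cost M : Prop :=
  exists C : R, forall x a, actions M x a -> (`|cost M x a| <= C)%R.

End Criteria.

Section Topological.
Context {R : realType} {X : countType} {S : completeMetricType R}.
Implicit Type M : mdp R X S.

(** [A] is the action space, inside the ambient Polish space [S]. *)
Definition countable_state_mdp (A : set S) M : Prop :=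
  [/\ measurable (A : set (borelType S)),
      forall x, [/\ actions M x !=set0, actions M x `<=` A &
                    measurable (actions M x : set (borelType S))],
      forall x, measurable_fun (actions M x : set (borelType S)) (cost M x),
      (forall x y, (forall a, actions M x a -> 0 <= rate M x a y) /\
         measurable_fun (actions M x : set (borelType S))
           (fun a => rate M x a y)) &
      (ereal_sup [set total_rate M xa.1 xa.2 |
                  xa in [set xa | actions M xa.1 xa.2]] < +oo)%E].

(** Semicontinuity and continuity are relative to [actions M x]. *)
Definition compactness_conditions M : Prop :=
  [/\ forall x, compact (actions M x),
      forall x, lower_semicontinuous
        (fun a : subspace (actions M x) => (cost M x a)%:E),
      forall x y, {within actions M x, continuous (fun a => rate M x a y)} &
      forall x, {within actions M x, continuous (total_rate M x)}].

End Topological.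

(** [None] is the additional state and the additional action. *)
Section HVAG.
Context {R : realType} {X : countType} {S : Type}.
Variables (M : mdp R X S) (l : X) (mu : X -> R) (b : R).

Definition hvag_actions (x : option X) : set (option S) :=
  if x is Some x then Some @` actions M x else [set None].

Definition hvag_cost (x : option X) (a : option S) : R :=
  match x, a with
  | Some x, Some a => (mu x)^-1 * cost M x a
  | _, _ => 0
  end.

(** [z / 0 = 0] also supplies the convention for [b = 0].  The hypotheses on
    [mu] make the sum under [fine] finite. *)
Definition hvag_rate (x : option X) (a : option S) (y : option X) : R :=
  match x, a, y with
  | Some x, Some a, Some y =>
      if y == l then
        (b * mu x)^-1 *
          (mu x - 1 - fine (\esum_(z in [set~ l]) (rate M x a z * mu z)%:E))
      else (b * mu x)^-1 * (rate M x a y * mu y)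
  | Some x, Some a, None => 1 - (b * mu x)^-1 * (mu x - 1)
  | _, _, y => (y == None)%:R
  end.

Definition hvag : mdp R (option X) (option S) :=
  MDP hvag_actions hvag_cost hvag_rate.

Definition hvag_policy (phi : X -> S) : option X -> option S := omap phi.

Definition hvag_value (x : option X) : \bar R :=
  ereal_inf [set discounted_cost hvag b (hvag_policy phi) x |
             phi in policy M].

End HVAG.

(* Main.v *)
Require Import Defs.
From mathcomp Require Import all_boot all_order all_algebra.
From mathcomp Require Import all_classical all_reals all_analysis.
From mathcomp Require Import finmap ring lra.

Set Implicit Arguments.
Unset Strict Implicit.
Unset Printing Implicit Defensive.

Import Order.TTheory GRing.Theory Num.Theory.
Import numFieldNormedType.Exports.

Local Open Scope classical_set_scope.
Local Open Scope ring_scope.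

(** The Bellman equation is solved before anything is known about [hvag_value]: a bounded real
    solution [u] is constructed, then identified with the value function, since [u] lies below the
    discounted cost of every policy and equals that of a minimizing one. The algebra with [mu] works
    because a transformed row keeps mass (mu x - 1)/(b mu x) in [X], whatever the action, and puts
    at [l] what the other states leave of it. So the action enters only through the cost and the
    expectation of [h], which vanishes at [l]. The remaining mass leaks to an absorbing state of
    cost zero, where [u] is zero; the leak is nonnegative because [b >= (K - 1) / K] and [mu <= K]
    give (1 - b) mu x <= 1. When [b] is zero the quotients degenerate and the link between the two
    equations needs its own argument. Signed sums and matrix powers over the extended reals are
    translated into expectations of bounded real functions under stochastic kernels, where linearity
    and monotonicity are available. *)

(** Write [u] for the value function of the transformed discounted problem and
    [h = mu (u - u l)].  Multiplying the discounted Bellman operator at [x] by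
    [mu x] gives [c + q h + (mu x - 1) u l], while [mu x * u x] is
    [h x + mu x * u l]; so the discounted Bellman equation for [u] is the
    average-cost optimality equation for [(u l, h)], with the same minimizing
    actions.  Since [h] is bounded, iterating [w + h <= c + Q h] gives
    [N w + h <= \sum_(n < N) Q^n c + Q^N h], and dividing by [N] shows that
    [w] bounds the average cost of every policy, with equality for the policies
    selecting minimizers. *)

(** * Unconditional real sums *)

Section RealSums.
Context {R : realType} {X : choiceType}.
Implicit Types f g : X -> R.

Definition rsummable f := summable [set: X] (EFin \o f).

(** [fine] sends infinite values to 0, so the value is meaningful only under [rsummable]. *)
Definition rsum f : R := fine (csum (EFin \o f)).

Lemma ge0_rsummable f : (forall x, 0 <= f x) ->
  rsummable f = (\esum_(x in [set: X]) (f x)%:E < +oo)%E.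
Proof.
move=> f0; rewrite /rsummable /summable; congr (_ < +oo)%E.
by apply: eq_esum => x _; rewrite /= ger0_norm.
Qed.

Lemma ge0_csum f : (forall x, 0 <= f x) ->
  csum (EFin \o f) = \esum_(x in [set: X]) (f x)%:E.
Proof.
move=> f0; rewrite /csum [X in (_ - X)%E]esum1 ?sube0.
  by apply: eq_esum => x _; rewrite funeposE/=; apply/max_idPl; rewrite lee_fin.
by move=> x _; rewrite funenegE/=; apply/max_idPr; rewrite lee_fin oppr_le0.
Qed.

Lemma ge0_rsumE f : (forall x, 0 <= f x) -> rsummable f ->
  \esum_(x in [set: X]) (f x)%:E = (rsum f)%:E.
Proof.
move=> f0; rewrite (ge0_rsummable f0) /rsum ge0_csum// => sf.
by rewrite fineK// ge0_fin_numE// esum_ge0// => x _; rewrite lee_fin.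
Qed.

Lemma rsummable_le f g : (forall x, `|f x| <= g x) -> rsummable g ->
  rsummable f.
Proof.
move=> fg; apply: le_lt_trans; apply: le_esum => x _ /=.
by rewrite lee_fin (le_trans (fg x)) ?ler_norm.
Qed.

Lemma rsummable_norm f : rsummable f -> rsummable (fun x => `|f x|).
Proof.
by apply: le_lt_trans; apply: le_esum => x _ /=; rewrite normr_id.
Qed.

Lemma rsummableD f g : rsummable f -> rsummable g ->
  rsummable (fun x => f x + g x).
Proof. exact: summableD. Qed.

Lemma rsummableN f : rsummable f -> rsummable (fun x => - f x).
Proof. by rewrite /rsummable summableN. Qed.

Lemma csum_rsum f : rsummable f -> csum (EFin \o f) = (rsum f)%:E.
Proof.
move=> sf; rewrite /rsum fineK// /csum fin_numB; apply/andP; split.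
  have := summable_funepos sf.
  by rewrite summableE (@eq_esum _ _ _ _ ((EFin \o f)^\+)%E)// => x _; rewrite gee0_abs.
have := summable_funeneg sf.
by rewrite summableE (@eq_esum _ _ _ _ ((EFin \o f)^\-)%E)// => x _; rewrite gee0_abs.
Qed.

(** [csum] is defined by positive and negative parts; [esumB] shows that any decomposition into two
    summable nonnegative families gives the same value. *)
Lemma ge0_rsumB f g : (forall x, 0 <= f x) -> (forall x, 0 <= g x) ->
  rsummable f -> rsummable g -> rsum (fun x => f x - g x) = rsum f - rsum g.
Proof.
move=> f0 g0 sf sg; apply: EFin_inj.
rewrite -csum_rsum; last exact/rsummableD/rsummableN.
rewrite EFinB -(ge0_rsumE f0 sf) -(ge0_rsumE g0 sg).
by rewrite -(esumB sf sg)// => x _ /=; rewrite lee_fin.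
Qed.

Lemma ge0_rsumD f g : (forall x, 0 <= f x) -> (forall x, 0 <= g x) ->
  rsummable f -> rsummable g -> rsum (fun x => f x + g x) = rsum f + rsum g.
Proof.
move=> f0 g0 sf sg; apply: EFin_inj.
rewrite -ge0_rsumE; [|by move=> x; rewrite addr_ge0|exact: rsummableD].
rewrite EFinD -(ge0_rsumE f0 sf) -(ge0_rsumE g0 sg) -esumD//.
- by move=> x _; rewrite lee_fin.
- by move=> x _; rewrite lee_fin.
Qed.

(** Writes a signed family as a difference of nonnegative ones, to transfer additivity and scaling
    from the nonnegative case. *)
Lemma rsumE f : rsummable f ->
  rsum f = rsum (fun x => `|f x| + f x) - rsum (fun x => `|f x|).
Proof.
move=> sf; rewrite -ge0_rsumB//.
- by congr rsum; apply/funext => x /=; rewrite addrAC subrr add0r.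
- by move=> x; rewrite -lerBlDr sub0r -normrN ler_norm.
- by apply: rsummableD => //; exact: rsummable_norm.
- exact: rsummable_norm.
Qed.

Lemma rsumD f g : rsummable f -> rsummable g ->
  rsum (fun x => f x + g x) = rsum f + rsum g.
Proof.
move=> sf sg; have nf := rsummable_norm sf; have ng := rsummable_norm sg.
have pos h x : 0 <= `|h x| + h x :> R.
  by rewrite -lerBlDr sub0r -normrN ler_norm.
have npos h x : 0 <= `|h x| :> R by [].
rewrite (rsumE sf) (rsumE sg) addrACA -opprD -!ge0_rsumD//; last 2 first.
- exact: rsummableD.
- exact: rsummableD.
rewrite -ge0_rsumB.
- by congr rsum; apply/funext => x /=; ring.
- by move=> x; rewrite addr_ge0.
- by move=> x; rewrite addr_ge0.
- by do 2!apply: rsummableD => //.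
- exact: rsummableD.
Qed.

Lemma rsum0 : rsum (fun _ => 0) = 0.
Proof. by rewrite /rsum ge0_csum// esum1. Qed.

Lemma rsumN f : rsummable f -> rsum (fun x => - f x) = - rsum f.
Proof.
move=> sf; apply/eqP; rewrite -addr_eq0 -rsumD//; last exact: rsummableN.
by under eq_fun do rewrite addNr; rewrite rsum0.
Qed.

Lemma rsumB f g : rsummable f -> rsummable g ->
  rsum (fun x => f x - g x) = rsum f - rsum g.
Proof. by move=> sf sg; rewrite rsumD ?rsumN//; exact: rsummableN. Qed.

Lemma ge0_esumZl (r : R) f : 0 <= r -> (forall x, 0 <= f x) ->
  \esum_(x in [set: X]) (r * f x)%:E =
  (r%:E * \esum_(x in [set: X]) (f x)%:E)%E.
Proof.
move=> r0 f0; rewrite /esum -ereal_supZl//; last first.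
  apply/set0P; exists (\sum_(x \in set0) (f x)%:E)%E, set0 => //; exact: fsets_set0.
congr ereal_sup; apply/seteqP; split => [_ [A fA <-]|_ [_ [A fA <-] <-]].
  exists (\sum_(x \in A) (f x)%:E)%E; first by exists A.
  by rewrite ge0_mule_fsumr// => x; rewrite lee_fin.
by exists A => //; rewrite ge0_mule_fsumr// => x; rewrite lee_fin.
Qed.

Lemma rsummableZ (r : R) f : rsummable f -> rsummable (fun x => r * f x).
Proof.
move=> /rsummable_norm nf.
have h : rsummable (fun x => `|r| * `|f x|).
  rewrite ge0_rsummable; last by move=> x; rewrite mulr_ge0.
  rewrite ge0_esumZl// ge0_rsumE//; exact: ltry.
by apply: (rsummable_le _ h) => x; rewrite normrM.
Qed.

Lemma ge0_rsumZ (r : R) f : 0 <= r -> (forall x, 0 <= f x) -> rsummable f ->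
  rsum (fun x => r * f x) = r * rsum f.
Proof.
move=> r0 f0 sf; apply: EFin_inj; rewrite EFinM -ge0_rsumE.
- by rewrite ge0_esumZl// ge0_rsumE.
- by move=> x; rewrite mulr_ge0.
- exact: rsummableZ.
Qed.

Lemma rsumZ (r : R) f : rsummable f -> rsum (fun x => r * f x) = r * rsum f.
Proof.
have H (s : R) g : 0 <= s -> rsummable g -> rsum (fun x => s * g x) = s * rsum g.
  move=> s0 sg; have ng := rsummable_norm sg.
  rewrite (rsumE sg) mulrBr -!ge0_rsumZ//; last 2 first.
  - by move=> x; rewrite -lerBlDr sub0r -normrN ler_norm.
  - exact: rsummableD.
  rewrite -rsumB; [|exact/rsummableZ/rsummableD|exact: rsummableZ].
  by congr rsum; apply/funext => x /=; rewrite mulrDr addrAC subrr add0r.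
move=> sf; have [r0|/ltW r0] := leP 0 r; first exact: H.
rewrite -[in RHS](opprK r) mulNr -H ?oppr_ge0// -rsumN.
  by congr rsum; apply/funext => x; rewrite mulNr opprK.
exact: rsummableZ.
Qed.

Lemma rsum_ge0 f : (forall x, 0 <= f x) -> rsummable f -> 0 <= rsum f.
Proof.
move=> f0 sf; rewrite -lee_fin -ge0_rsumE// esum_ge0// => x _.
by rewrite lee_fin.
Qed.

Lemma ler_rsum f g : rsummable f -> rsummable g ->
  (forall x, f x <= g x) -> rsum f <= rsum g.
Proof.
move=> sf sg fg; rewrite -subr_ge0 -rsumB//; apply: rsum_ge0.
  by move=> x; rewrite subr_ge0.
exact/rsummableD/rsummableN.
Qed.

Lemma esum_delta a (r : R) : 0 <= r ->
  \esum_(x in [set: X]) (if x == a then r else 0)%:E = r%:E.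
Proof.
move=> r0; rewrite (esumID [set a])/=; last first.
  by move=> x _; rewrite lee_fin; case: ifP.
rewrite setTI esum_set1 ?eqxx ?lee_fin// esum1 ?adde0// => x [_ /= /eqP].
by move=> /negbTE ->.
Qed.

Lemma rsummable_delta a (r : R) : rsummable (fun x => if x == a then r else 0).
Proof.
have h : rsummable (fun x => if x == a then `|r| else 0).
  by rewrite ge0_rsummable ?esum_delta ?ltry// => x; case: ifP.
by apply: (rsummable_le _ h) => x; case: ifP => //; rewrite normr0.
Qed.

Lemma rsum_delta a (r : R) : rsum (fun x => if x == a then r else 0) = r.
Proof.
have -> : (fun x => if x == a then r else 0) =
          (fun x => r * (if x == a then 1 else 0)).
  by apply/funext => x; case: ifP; rewrite ?mulr1 ?mulr0.
rewrite rsumZ; last exact: rsummable_delta.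
suff -> : rsum (fun x => if x == a then 1 else 0) = 1 by rewrite mulr1.
apply: EFin_inj; rewrite -ge0_rsumE ?esum_delta//; last exact: rsummable_delta.
by move=> x; case: ifP.
Qed.

(** Finite truncations approach a nonnegative sum from below; this later turns entrywise continuity
    into lower semicontinuity of expectations. *)
Lemma lt_rsum_finite f (t : R) : (forall x, 0 <= f x) -> rsummable f ->
  t < rsum f -> exists F : {fset X}, t < \sum_(x <- F) f x.
Proof.
move=> f0 sf; rewrite -lte_fin -ge0_rsumE// => /ereal_sup_gt[_ [A [fA _] <-]].
move=> h; exists (fset_set A) => //.
by rewrite -lte_fin -sumEFin -fsbig_finite.
Qed.

Lemma sum_le_rsum f (F : {fset X}) : (forall x, 0 <= f x) -> rsummable f ->
  \sum_(x <- F) f x <= rsum f.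
Proof.
move=> f0 sf; rewrite -lee_fin -ge0_rsumE// -sumEFin; apply: esum_ge.
exists [set` F]; first by split.
by rewrite fsbig_finite// set_fsetK.
Qed.

End RealSums.

(** * Sums over a set with one added point, and interchange of sums *)

Lemma esum_option {R : realType} {X : choiceType} (f : option X -> R) :
  (forall x, 0 <= f x) ->
  \esum_(x in [set: option X]) (f x)%:E =
  ((f None)%:E + \esum_(x in [set: X]) (f (Some x))%:E)%E.
Proof.
move=> f0; rewrite (esumID [set None])/=; last by move=> x _; rewrite lee_fin.
rewrite setTI esum_set1 ?lee_fin//; congr (_ + _)%E.
rewrite -(@esum_image R X (option X) setT Some (fun x => (f x)%:E)).
  congr (esum _ _); apply/seteqP; split => [[x [_ _]|[_ []]//]|_ [x _ <-]//].
    by exists x.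
by move=> x y _ _ [].
Qed.

Lemma rsummable_option {R : realType} {X : choiceType} (f : option X -> R) :
  rsummable (f \o Some) -> rsummable f.
Proof.
move=> /rsummable_norm; rewrite ge0_rsummable// => sf.
rewrite /rsummable /summable.
by rewrite (esum_option (f := fun x => `|f x|))// lte_add_pinfty// ltry.
Qed.

Lemma rsum_option {R : realType} {X : choiceType} (f : option X -> R) :
  rsummable (f \o Some) -> rsum f = f None + rsum (f \o Some).
Proof.
move=> sf; have H (g : option X -> R) :
    (forall x, 0 <= g x) -> rsummable (g \o Some) ->
    rsum g = g None + rsum (g \o Some).
  move=> g0 sg; apply: EFin_inj; rewrite EFinD.
  rewrite -(ge0_rsumE g0 (rsummable_option sg)).
  by rewrite -(ge0_rsumE (fun x => g0 (Some x)) sg) esum_option.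
have nf := rsummable_norm sf.
rewrite (rsumE sf) (rsumE (rsummable_option sf)) !H//; last 2 first.
- by move=> x; rewrite -lerBlDr sub0r -normrN ler_norm.
- exact: rsummableD.
by rewrite /=; ring.
Qed.

(** Tonelli: both iterated sums equal the sum over pairs, up to swapping coordinates. Each column is
    summable because an entry is at most its row sum. *)
Lemma rsum_exchange {R : realType} {X Y : choiceType} (F : X -> Y -> R) :
  (forall x y, 0 <= F x y) -> (forall x, rsummable (F x)) ->
  rsummable (fun x => rsum (F x)) ->
  [/\ forall y, rsummable (F^~ y), rsummable (fun y => rsum (F^~ y)) &
      rsum (fun y => rsum (F^~ y)) = rsum (fun x => rsum (F x))].
Proof.
move=> F0 sF ssF.
have sF' y : rsummable (F^~ y).
  apply: (rsummable_le _ ssF) => x.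
  rewrite ger0_norm//.
  apply: le_trans (sum_le_rsum [fset y]%fset (F0 x) (sF x)).
  by rewrite big_seq_fset1.
have r0 x : 0 <= rsum (F x) by exact: rsum_ge0.
have r0' y : 0 <= rsum (F^~ y) by exact: rsum_ge0.
have E : \esum_(y in [set: Y]) (rsum (F^~ y))%:E =
         \esum_(x in [set: X]) (rsum (F x))%:E.
  rewrite (@eq_esum _ _ _ _ (fun y => \esum_(x in [set: X]) (F x y)%:E)%E).
    rewrite [RHS](@eq_esum _ _ _ _ (fun x => \esum_(y in [set: Y]) (F x y)%:E)%E).
      rewrite !esum_esum; try by move=> *; rewrite lee_fin.
      rewrite (@reindex_esum _ _ _ ([set: X] `*`` fun=> [set: Y]) _
        (fun z => (z.2, z.1)))//.
      split => //.
      - by move=> [x1 y1] [x2 y2] _ _ [-> ->].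
      - by move=> [y x] _; exists (x, y).
    by move=> x _; rewrite ge0_rsumE.
  by move=> y _; rewrite ge0_rsumE.
have s : rsummable (fun y => rsum (F^~ y)).
  by rewrite ge0_rsummable// E -ge0_rsummable.
by split=> //; apply: EFin_inj; rewrite -!ge0_rsumE.
Qed.

(** * Stochastic matrices and their iterates *)

Section Expectation.
Context {R : realType} {X : choiceType}.
Implicit Types (p u v : X -> R) (B r : R).

Definition prob p :=
  (forall x, 0 <= p x) /\ \esum_(x in [set: X]) (p x)%:E = 1%E.

Definition bnd u := exists B, forall x, `|u x| <= B.

Definition expect p u : R := rsum (fun x => p x * u x).

Lemma prob_rsummable p : prob p -> rsummable p.
Proof. by move=> [p0 p1]; rewrite ge0_rsummable// p1 ltry. Qed.

Lemma prob_rsum p : prob p -> rsum p = 1.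
Proof.
by move=> pp; apply: EFin_inj; rewrite -(ge0_rsumE pp.1 (prob_rsummable pp)) pp.2.
Qed.

Lemma expect_rsummable p u : prob p -> bnd u -> rsummable (fun x => p x * u x).
Proof.
move=> pp [B uB]; have h := rsummableZ B (prob_rsummable pp).
apply: (rsummable_le _ h) => x.
by rewrite normrM (ger0_norm (pp.1 x)) mulrC ler_wpM2r// pp.1.
Qed.

Lemma bndD u v : bnd u -> bnd v -> bnd (fun x => u x + v x).
Proof.
move=> [B uB] [C vC]; exists (B + C) => x.
exact: le_trans (ler_normD _ _) (lerD _ _).
Qed.

Lemma bndM u v : bnd u -> bnd v -> bnd (fun x => u x * v x).
Proof.
by move=> [B uB] [C vC]; exists (B * C) => x; rewrite normrM ler_pM.
Qed.

Lemma bnd_cst r : bnd (fun=> r).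
Proof. by exists `|r|. Qed.

Lemma bndN u : bnd u -> bnd (fun x => - u x).
Proof. by move=> [B uB]; exists B => x; rewrite normrN. Qed.

Lemma bndB u v : bnd u -> bnd v -> bnd (fun x => u x - v x).
Proof. by move=> bu bv; apply: bndD => //; exact: bndN. Qed.

Lemma bndZ r u : bnd u -> bnd (fun x => r * u x).
Proof. exact/bndM/bnd_cst. Qed.

Lemma expectD p u v : prob p -> bnd u -> bnd v ->
  expect p (fun x => u x + v x) = expect p u + expect p v.
Proof.
move=> pp bu bv; rewrite /expect -rsumD; try exact: expect_rsummable.
by congr rsum; apply/funext => x; rewrite mulrDr.
Qed.

Lemma expectZ p r u : prob p -> bnd u ->
  expect p (fun x => r * u x) = r * expect p u.
Proof.
move=> pp bu; rewrite /expect -rsumZ; last exact: expect_rsummable.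
by congr rsum; apply/funext => x; rewrite mulrCA.
Qed.

Lemma expectN p u : prob p -> bnd u ->
  expect p (fun x => - u x) = - expect p u.
Proof.
move=> pp bu; rewrite -mulN1r -expectZ//.
by congr expect; apply/funext => x; rewrite mulN1r.
Qed.

Lemma expectB p u v : prob p -> bnd u -> bnd v ->
  expect p (fun x => u x - v x) = expect p u - expect p v.
Proof. by move=> pp bu bv; rewrite expectD ?expectN//; exact: bndN. Qed.

Lemma expect_cst p r : prob p -> expect p (fun=> r) = r.
Proof.
move=> pp; rewrite /expect; under eq_fun do rewrite mulrC.
by rewrite rsumZ ?prob_rsum ?mulr1//; exact: prob_rsummable.
Qed.

Lemma le_expect p u v : prob p -> bnd u -> bnd v ->
  (forall x, u x <= v x) -> expect p u <= expect p v.
Proof.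
move=> pp bu bv uv; apply: ler_rsum; try exact: expect_rsummable.
by move=> x; rewrite ler_wpM2l// pp.1.
Qed.

Lemma norm_expect_le p u B : prob p -> (forall x, `|u x| <= B) ->
  `|expect p u| <= B.
Proof.
move=> pp uB; have bu : bnd u by exists B.
rewrite ler_norml; apply/andP; split.
  rewrite -[leLHS](expect_cst (- B) pp); apply: le_expect => //.
    exact: bnd_cst.
  by move=> x; have := uB x; rewrite ler_norml => /andP[].
rewrite -[leRHS](expect_cst B pp); apply: le_expect => //.
  exact: bnd_cst.
by move=> x; have := uB x; rewrite ler_norml => /andP[].
Qed.

Lemma csum_expect p u : prob p -> bnd u ->
  csum (fun x => (p x)%:E * (u x)%:E)%E = (expect p u)%:E.
Proof. by move=> pp bu; rewrite -csum_rsum//; exact: expect_rsummable. Qed.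

(** In this argument order the kernel [pdelta] is [imx_id] entry by entry, hence the zeroth matrix
    power. *)
Definition pdelta (a x : X) : R := (a == x)%:R.

Lemma prob_delta a : prob (pdelta a).
Proof.
split=> [x|]; first by rewrite /pdelta ler0n.
rewrite -(esum_delta a (@ler01 R)); apply: eq_esum => x _.
by rewrite /pdelta eq_sym; case: eqP.
Qed.

Lemma expect_delta a u : expect (pdelta a) u = u a.
Proof.
rewrite /expect -[RHS](rsum_delta a (u a)); congr rsum; apply/funext => x.
by rewrite /pdelta eq_sym; case: eqP => [->|_]; rewrite ?mul1r ?mul0r.
Qed.

End Expectation.

(** * Powers of a stochastic matrix acting on bounded functions *)

Section Kernels.
Context {R : realType} {X : choiceType}.
Implicit Types (P Q : X -> X -> R) (p u g c : X -> R).

Definition kernel P := forall x, prob (P x).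

Definition transit P u x : R := expect (P x) u.

Definition compose p Q (y : X) : R := expect p (Q^~ y).

Lemma bnd_prob Q y : kernel Q -> bnd (Q^~ y).
Proof.
move=> kQ; exists 1 => x; have [Q0 _] := kQ x.
rewrite ger0_norm// -(prob_rsum (kQ x)).
apply: le_trans (sum_le_rsum [fset y]%fset Q0 (prob_rsummable (kQ x))).
by rewrite big_seq_fset1.
Qed.

Lemma bnd_transit P u : kernel P -> bnd u -> bnd (transit P u).
Proof. by move=> kP [B uB]; exists B => x; exact: norm_expect_le. Qed.

(** Nonnegativity of [u] permits the interchange of sums. Summability is part of the conclusion
    because [compose p Q] is not yet known to be a probability; the case where [u] is the constant 1
    will show that it is. *)
Lemma prob_compose_ge0 p Q u : prob p -> kernel Q -> bnd u ->
  (forall x, 0 <= u x) ->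
  rsummable (fun y => compose p Q y * u y) /\
  expect (compose p Q) u = expect p (transit Q u).
Proof.
move=> pp kQ bu u0; pose F z y := p z * (Q z y * u y).
have F0 z y : 0 <= F z y by rewrite !mulr_ge0 ?pp.1//; case: (kQ z).
have sF z : rsummable (F z) by exact/rsummableZ/expect_rsummable.
have FE z : rsum (F z) = p z * transit Q u z.
  by rewrite rsumZ//; exact: expect_rsummable.
have sF' : rsummable (fun z => rsum (F z)).
  by under eq_fun do rewrite FE; exact/expect_rsummable/bnd_transit.
have [_] := rsum_exchange F0 sF sF'.
have -> : (fun y => rsum (F^~ y)) = (fun y => compose p Q y * u y).
  apply/funext => y; rewrite /compose mulrC -rsumZ; last first.
    exact/expect_rsummable/bnd_prob.
  by congr rsum; apply/funext => z; rewrite /F mulrA mulrC.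
by move=> ? E; split=> //; rewrite /expect E; under eq_fun do rewrite FE.
Qed.

Lemma prob_compose p Q : prob p -> kernel Q -> prob (compose p Q).
Proof.
move=> pp kQ; have h0 y : 0 <= compose p Q y.
  apply: rsum_ge0; last exact/expect_rsummable/bnd_prob.
  by move=> x; rewrite mulr_ge0 ?pp.1//; case: (kQ x).
have [] := prob_compose_ge0 pp kQ (bnd_cst 1) (fun=> ler01).
rewrite /expect (_ : (fun y => compose p Q y * 1) = compose p Q); last first.
  by apply/funext => y /=; rewrite mulr1.
move=> s E; split=> //; rewrite ge0_rsumE// E.
rewrite [in RHS](_ : 1%E = (1 : R)%:E)//; congr EFin.
rewrite -[RHS](prob_rsum pp); congr rsum; apply/funext => x.
by rewrite /transit expect_cst// mulr1.
Qed.

(** Adding a bound [B] makes [u] nonnegative, and this constant contributes [B] to both sides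
    because all rows have mass one. *)
Lemma expect_compose p Q u : prob p -> kernel Q -> bnd u ->
  expect (compose p Q) u = expect p (transit Q u).
Proof.
move=> pp kQ bu; have [B uB] := bu.
have bB := bnd_cst B : bnd (fun _ : X => B).
have uB0 x : 0 <= u x + B.
  by have := uB x; rewrite ler_norml => /andP[h _]; rewrite -lerBlDr sub0r.
have [_] := prob_compose_ge0 pp kQ (bndD bu bB) uB0.
have -> : transit Q (fun x => u x + B) = (fun x => transit Q u x + B).
  by apply/funext => x; rewrite /transit expectD// expect_cst.
rewrite !expectD ?expect_cst//; first exact: addIr.
all: by [exact: prob_compose|exact: bnd_transit].
Qed.

(** The bridge from extended real matrix powers to iterates of a real operator. The induction
    carries the kernel [Q] along because its boundedness gives the summability needed for the next
    product. *)
Lemma imx_exp_kernel P n : kernel P -> exists Q, [/\ kernel Q,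
  imx_exp (fun x y => (P x y)%:E) n = (fun x y => (Q x y)%:E) &
  forall u, bnd u -> transit Q u = iter n (transit P) u].
Proof.
move=> kP; elim: n => [|n [Q [kQ QE Qu]]].
  exists (@pdelta R X); split => //.
    by move=> x; exact: prob_delta.
  by move=> u _; apply/funext => x; rewrite /transit expect_delta.
exists (fun x => compose (P x) Q); split.
- by move=> x; exact: prob_compose.
- rewrite /imx_exp iterS -/(imx_exp _ n) QE; apply/funext => x; apply/funext => y.
  by rewrite /imx_mul csum_expect//; exact: bnd_prob.
- move=> u bu; rewrite iterS -Qu//; apply/funext => x.
  by rewrite /transit expect_compose.
Qed.

Lemma imx_act_iter P u n x : kernel P -> bnd u ->
  imx_act (imx_exp (fun x y => (P x y)%:E) n) (fun y => (u y)%:E) x =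
  (iter n (transit P) u x)%:E.
Proof.
move=> kP bu; have [Q [kQ -> <-]] := imx_exp_kernel n kP => //.
by rewrite /imx_act csum_expect.
Qed.

Lemma norm_iter_transit P u (B : R) n x : kernel P -> (forall y, `|u y| <= B) ->
  `|iter n (transit P) u x| <= B.
Proof.
move=> kP uB; have [Q [kQ _ <-]] := imx_exp_kernel n kP; last by exists B.
exact: norm_expect_le.
Qed.

Lemma iter_transit_lin P n (r : R) u v : kernel P -> bnd u -> bnd v -> forall x,
  iter n (transit P) (fun y => u y + r * v y) x =
  iter n (transit P) u x + r * iter n (transit P) v x.
Proof.
move=> kP bu bv x; have [Q [kQ _ QE]] := imx_exp_kernel n kP.
rewrite -!QE//; last exact/bndD/bndZ.
by rewrite /transit expectD ?expectZ//; exact: bndZ.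
Qed.

Lemma le_iter_transit P n u v : kernel P -> bnd u -> bnd v ->
  (forall y, u y <= v y) -> forall x,
  iter n (transit P) u x <= iter n (transit P) v x.
Proof.
move=> kP bu bv uv x; have [Q [kQ _ QE]] := imx_exp_kernel n kP.
by rewrite -!QE//; exact: le_expect.
Qed.

Lemma iter_transit_cst P n (r : R) x : kernel P ->
  iter n (transit P) (fun=> r) x = r.
Proof.
move=> kP; have [Q [kQ _ <-]] := imx_exp_kernel n kP; last exact: bnd_cst.
exact: expect_cst.
Qed.

(** The induction step applies the hypothesis under the [N]-th iterate, which is monotone and
    linear. The factor [b] may be 1: this case serves the average cost, the case [b < 1] the
    discounted one. *)
Lemma iterate_le P (b : R) g c N : kernel P -> 0 <= b -> bnd g -> bnd c ->
  (forall x, g x <= c x + b * transit P g x) -> forall x,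
  g x <= \sum_(0 <= n < N) b ^+ n * iter n (transit P) c x +
         b ^+ N * iter N (transit P) g x.
Proof.
move=> kP b0 bg bc gc x; elim: N => [|N IH].
  by rewrite big_geq// add0r expr0 mul1r.
apply: (le_trans IH); rewrite big_nat_recr//= -addrA lerD2l exprSr -mulrA -mulrDr.
rewrite ler_wpM2l ?exprn_ge0//.
have bT := bnd_transit kP bg.
apply: (@le_trans _ _ (iter N (transit P) (fun y => c y + b * transit P g y) x)).
  by apply: le_iter_transit => //; exact/bndD/bndZ.
by rewrite iter_transit_lin// -iterSr.
Qed.

Lemma iterate_ge P (b : R) g c N : kernel P -> 0 <= b -> bnd g -> bnd c ->
  (forall x, c x + b * transit P g x <= g x) -> forall x,
  \sum_(0 <= n < N) b ^+ n * iter n (transit P) c x +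
    b ^+ N * iter N (transit P) g x <= g x.
Proof.
move=> kP b0 bg bc gc x; elim: N => [|N IH].
  by rewrite big_geq// add0r expr0 mul1r.
apply: le_trans IH; rewrite big_nat_recr//= -addrA lerD2l exprSr -mulrA -mulrDr.
rewrite ler_wpM2l ?exprn_ge0//.
have bT := bnd_transit kP bg.
apply: (@le_trans _ _ (iter N (transit P) (fun y => c y + b * transit P g y) x)).
  by rewrite iter_transit_lin// -iterSr.
by apply: le_iter_transit => //; exact/bndD/bndZ.
Qed.

End Kernels.

(** * Discounted and average costs *)

Section Criteria.
Context {R : realType} {X : choiceType}.
Implicit Types (P : X -> X -> R) (g c h : X -> R).

Lemma cvg_expr_iter (b : R) P g x : 0 <= b < 1 -> kernel P -> bnd g ->
  b ^+ N * iter N (transit P) g x @[N --> \oo] --> 0.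
Proof.
move=> /andP[b0 b1] kP [B gB]; apply/norm_cvg0P.
have cB : b ^+ N * B @[N --> \oo] --> 0.
  rewrite -(mul0r B); apply: cvgMr_tmp; apply: cvg_expr.
  by rewrite ger0_norm.
apply: (squeeze_cvgr _ (cvg_cst 0) cB); near=> N.
rewrite normr_ge0/= normrM (ger0_norm (exprn_ge0 _ b0)).
by rewrite ler_wpM2l ?exprn_ge0// norm_iter_transit.
Unshelve. all: by end_near. Qed.

Lemma is_cvg_discounted (b : R) P c x : 0 <= b < 1 -> kernel P -> bnd c ->
  cvgn (fun N => \sum_(0 <= n < N) b ^+ n * iter n (transit P) c x).
Proof.
move=> /andP[b0 b1] kP [B cB].
apply: (@normed_cvg R R^o (fun n => b ^+ n * iter n (transit P) c x)).
apply: (@series_le_cvg _ _ (geometric B b)) => [n|n|n|] //=.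
- by rewrite mulr_ge0 ?exprn_ge0//; exact: le_trans (cB x).
- rewrite normrM (ger0_norm (exprn_ge0 _ b0)) mulrC.
  by rewrite ler_wpM2r ?exprn_ge0// norm_iter_transit.
- by apply: is_cvg_geometric_series; rewrite ger0_norm.
Qed.

Lemma eseries_discounted (b : R) P c x : 0 <= b < 1 -> kernel P -> bnd c ->
  (\sum_(0 <= n <oo) (b ^+ n)%:E *
    imx_act (imx_exp (fun x y => (P x y)%:E) n) (fun y => (c y)%:E) x =
  (limn (fun N => \sum_(0 <= n < N) b ^+ n * iter n (transit P) c x))%:E)%E.
Proof.
move=> b01 kP bc; rewrite -EFin_lim; last exact: is_cvg_discounted.
congr (limn _); apply/funext => N; rewrite /= -sumEFin.
by apply: eq_bigr => n _; rewrite imx_act_iter.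
Qed.

Lemma le_discounted (b : R) P g c x : 0 <= b < 1 -> kernel P ->
  bnd g -> bnd c -> (forall x, g x <= c x + b * transit P g x) ->
  ((g x)%:E <= \sum_(0 <= n <oo) (b ^+ n)%:E *
    imx_act (imx_exp (fun x y => (P x y)%:E) n) (fun y => (c y)%:E) x)%E.
Proof.
move=> b01 kP bg bc gc; rewrite eseries_discounted// lee_fin.
have cS := @is_cvg_discounted b P c x b01 kP bc.
have cR := @cvg_expr_iter b P g x b01 kP bg.
have := cvgD (FF := eventually_filter) cS cR; rewrite addr0 => cSR.
rewrite -(cvg_lim _ cSR)//.
apply: limr_ge; first exact: (cvgP _ cSR).
by near=> N; apply: iterate_le => //; case/andP: b01.
Unshelve. all: by end_near. Qed.

Lemma discounted_unique (b : R) P g c x : 0 <= b < 1 -> kernel P ->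
  bnd g -> bnd c -> (forall x, g x = c x + b * transit P g x) ->
  (\sum_(0 <= n <oo) (b ^+ n)%:E *
    imx_act (imx_exp (fun x y => (P x y)%:E) n) (fun y => (c y)%:E) x =
  (g x)%:E)%E.
Proof.
move=> b01 kP bg bc gc; apply/eqP; rewrite eq_le; apply/andP; split; last first.
  by apply: le_discounted => // y; rewrite -gc.
rewrite eseries_discounted// lee_fin.
have cS := @is_cvg_discounted b P c x b01 kP bc.
have cR := @cvg_expr_iter b P g x b01 kP bg.
have := cvgD (FF := eventually_filter) cS cR; rewrite addr0 => cSR.
rewrite -(cvg_lim _ cSR)//.
apply: limr_le; first exact: (cvgP _ cSR).
by near=> N; apply: iterate_ge => //; [case/andP: b01|move=> y; rewrite -gc].
Unshelve. all: by end_near. Qed.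

(** The average-cost inequality is the undiscounted one for the cost reduced by [w]; the powers of 1
    match [iterate_le] and [iterate_ge] at [b = 1]. *)
Lemma iterate_cost_shift P c (w : R) N x : kernel P -> bnd c ->
  \sum_(0 <= n < N) 1 ^+ n * iter n (transit P) (fun y => c y - w) x =
  \sum_(0 <= n < N) iter n (transit P) c x - N%:R * w.
Proof.
move=> kP bc; rewrite (eq_bigr (fun n => iter n (transit P) c x - w)).
  by rewrite sumrB; congr (_ - _); rewrite big_const_nat subn0 iter_addr_0 mulr_natl.
move=> n _; rewrite expr1n mul1r.
have -> : (fun y => c y - w) = (fun y => c y + -1 * w).
  by apply/funext => y; rewrite mulN1r.
by rewrite (iter_transit_lin n (-1) kP bc (bnd_cst w)) iter_transit_cst// mulN1r.
Qed.

Lemma average_sumE P c N x : kernel P -> bnd c ->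
  ((N%:R^-1)%:E * \sum_(0 <= n < N)
    imx_act (imx_exp (fun x y => (P x y)%:E) n) (fun y => (c y)%:E) x =
  (N%:R^-1 * \sum_(0 <= n < N) iter n (transit P) c x)%:E)%E.
Proof.
move=> kP bc; rewrite EFinM -sumEFin; congr (_ * _)%E.
by apply: eq_bigr => n _; rewrite imx_act_iter.
Qed.

Lemma cvg_cst_div (D w : R) : w + D * N%:R^-1 @[N --> \oo] --> w.
Proof.
rewrite -[X in _ --> X](addr0 w); apply: cvgD; first exact: cvg_cst.
rewrite -(mulr0 D); apply: cvgMl_tmp.
rewrite -cvg_shiftS; exact: cvg_harmonic.
Qed.

(** In [2 * B], one [B] bounds [h x] and the other the remainder, the [N]-th iterate of [h]. *)
Lemma average_ge P h c (w : R) N x B : kernel P -> bnd c ->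
  (forall x, `|h x| <= B) -> (forall x, w + h x <= c x + transit P h x) ->
  (0 < N)%N ->
  w + (- (2 * B)) * N%:R^-1 <=
  N%:R^-1 * \sum_(0 <= n < N) iter n (transit P) c x.
Proof.
move=> kP bc hB hc N0; have bh : bnd h by exists B.
have N0' : 0 < N%:R :> R by rewrite ltr0n.
have := @iterate_le R X P 1 h (fun y => c y - w) N kP ler01 bh.
move=> /(_ (bndB bc (bnd_cst w))) H.
have /H{H} : forall x, h x <= c x - w + 1 * transit P h x.
  by move=> y; rewrite mul1r; have := hc y; lra.
move=> /(_ x); rewrite iterate_cost_shift// expr1n mul1r.
have := @norm_iter_transit _ _ _ _ _ N x kP hB; have := hB x; rewrite !ler_norml.
move=> /andP[h1 _] /andP[_ h2] h3.
rewrite -(ler_pM2l N0') mulVKf ?gt_eqF// mulrDr [N%:R * (- _ * _)]mulrC mulfVK ?gt_eqF//.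
lra.
Qed.

Lemma average_le P h c (w : R) N x B : kernel P -> bnd c ->
  (forall x, `|h x| <= B) -> (forall x, c x + transit P h x <= w + h x) ->
  (0 < N)%N ->
  N%:R^-1 * \sum_(0 <= n < N) iter n (transit P) c x <= w + 2 * B * N%:R^-1.
Proof.
move=> kP bc hB hc N0; have bh : bnd h by exists B.
have N0' : 0 < N%:R :> R by rewrite ltr0n.
have := @iterate_ge R X P 1 h (fun y => c y - w) N kP ler01 bh.
move=> /(_ (bndB bc (bnd_cst w))) H.
have /H{H} : forall x, c x - w + 1 * transit P h x <= h x.
  by move=> y; rewrite mul1r; have := hc y; lra.
move=> /(_ x); rewrite iterate_cost_shift// expr1n mul1r.
have := @norm_iter_transit _ _ _ _ _ N x kP hB; have := hB x; rewrite !ler_norml.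
move=> /andP[_ h1] /andP[h2 _] h3.
rewrite -(ler_pM2l N0') mulVKf ?gt_eqF// mulrDr [N%:R * (_ * _)]mulrC mulfVK ?gt_eqF//.
lra.
Qed.

Lemma le_average P h c (w : R) x : kernel P -> bnd c -> bnd h ->
  (forall x, w + h x <= c x + transit P h x) ->
  (w%:E <= limn_esup (fun N => (N%:R^-1)%:E * \sum_(0 <= n < N)
    imx_act (imx_exp (fun x y => (P x y)%:E) n) (fun y => (c y)%:E) x))%E.
Proof.
move=> kP bc [B hB] hc; under eq_fun do rewrite average_sumE//.
(* [limn_esup] is an infimum, over neighbourhoods [V] of infinity, of suprema over [V]. Each such
   supremum dominates w - 2B/N for all large [N], hence also the limit [w]. *)
apply: le_ereal_inf_tmp => _ [V FV <-].
have cw := @cvg_cst_div (- (2 * B)) w.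
have {}cw : (w + (- (2 * B)) * N%:R^-1)%:E @[N --> \oo] --> w%:E.
  by apply: cvg_EFin; [exact: nearW|exact: cw].
rewrite -(cvg_lim _ cw)//; apply: lime_le; first exact: (cvgP _ cw).
near=> N; apply: (@le_trans _ _ (N%:R^-1 * \sum_(0 <= n < N) iter n (transit P) c x)%:E).
  by rewrite lee_fin; apply: average_ge => //; near: N; exact: nbhs_infty_gt.
apply: ereal_sup_ubound; exists N => //; near: N; exact: FV.
Unshelve. all: by end_near. Qed.

(** With equality the averages stay within 2B/N of [w], so the upper limit is a true limit. *)
Lemma average_unique P h c (w : R) x : kernel P -> bnd c -> bnd h ->
  (forall x, w + h x = c x + transit P h x) ->
  (limn_esup (fun N => (N%:R^-1)%:E * \sum_(0 <= n < N)
    imx_act (imx_exp (fun x y => (P x y)%:E) n) (fun y => (c y)%:E) x) = w%:E)%E.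
Proof.
move=> kP bc [B hB] hc; under eq_fun do rewrite average_sumE//.
apply: (cvg_limn_einf_sup _).2; apply: cvg_EFin; first exact: nearW.
apply: squeeze_cvgr (@cvg_cst_div (- (2 * B)) w) (@cvg_cst_div (2 * B) w).
near=> N; have N0 : (0 < N)%N by near: N; exact: nbhs_infty_gt.
apply/andP; split; first by apply: (average_ge x kP bc hB) => // y; rewrite hc.
by apply: (average_le x kP bc hB) => // y; rewrite hc.
Unshelve. all: by end_near. Qed.

End Criteria.

(** * Minimization over compact action sets *)

Section LowerSemicontinuity.
Context {R : realType} {T : topologicalType}.
Implicit Types (A : set T) (f g : T -> R).

Definition lsc_on A f := forall a t, A a -> t < f a ->
  \forall a' \near within A (nbhs a), t < f a'.

(** The sublevel sets of [f] at its own values are nested and nonempty, so they generate a proper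
    filter. A cluster point [p] is a minimizer: if [f a < f p], then [f] exceeds [f a] near [p],
    away from the sublevel set of [a]. *)
Lemma compact_lsc_min A f : A !=set0 -> compact A -> lsc_on A f ->
  exists2 a, A a & forall a', A a' -> f a <= f a'.
Proof.
move=> [a0 Aa0] cA lf.
pose F := filter_from A (fun a => A `&` [set a' | f a' <= f a]).
have FF : ProperFilter F.
  apply: filter_from_proper; last by move=> a Aa; exists a; split => /=.
  apply: filter_from_filter; first by exists a0.
  move=> a b Aa Ab; have [ab|ba] := leP (f a) (f b).
    exists a => // x [Ax /= xa]; split; split => //=; exact: le_trans ab.
  exists b => // x [Ax /= xb]; split; split => //=; exact: le_trans (ltW ba).
have [|p [Ap clp]] := cA F FF; first by exists a0 => // x [].
exists p => // a Aa; rewrite leNgt; apply/negP => /(lf _ _ Ap) near_p.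
have FB : F (A `&` [set a' | f a' <= f a]) by exists a.
have [x [[Ax /= xa] /(_ Ax)]] := clp _ _ FB near_p.
by rewrite ltNge xa.
Qed.

Lemma lsc_onD A f g : lsc_on A f -> lsc_on A g ->
  lsc_on A (fun a => f a + g a).
Proof.
move=> lf lg a t Aa tfg; pose e := (f a + g a - t) / 2.
have e0 : 0 < e by rewrite divr_gt0// subr_gt0.
have f1 : f a - e < f a by rewrite ltrBlDr ltrDl.
have g1 : g a - e < g a by rewrite ltrBlDr ltrDl.
apply: filterS2 (lf _ _ Aa f1) (lg _ _ Aa g1) => x fx gx.
by have := ltrD fx gx; rewrite /e; lra.
Qed.

Lemma lsc_onZ A (r : R) f : 0 <= r -> lsc_on A f -> lsc_on A (fun a => r * f a).
Proof.
rewrite le_eqVlt => /predU1P[<- _|r0 lf] a t Aa.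
  by rewrite mul0r => t0; apply: nearW => x; rewrite mul0r.
rewrite -ltr_pdivrMl// => /(lf _ _ Aa); apply: filterS => x.
by rewrite ltr_pdivrMl.
Qed.

Lemma lsc_on_cst A (r : R) : lsc_on A (fun=> r).
Proof. by move=> a t _ tr; exact: nearW. Qed.

Lemma lower_semicontinuous_lsc_on A f :
  lower_semicontinuous (fun a : subspace A => (f a)%:E) -> lsc_on A f.
Proof.
move=> lf a t Aa tf; have [|V aV Vf] := lf a t; first by rewrite lte_fin.
rewrite nbhs_subspace_in//; apply: filterS aV => x /Vf.
by rewrite lte_fin.
Qed.

(** A Fatou argument. After the shift by [B] the terms are nonnegative, so some finite partial sum
    already exceeds [t + B]; it is continuous in the action and stays below the full sum. *)
Lemma lsc_on_expect {X : choiceType} A (q : T -> X -> R) (u : X -> R) :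
  (forall a, A a -> prob (q a)) ->
  (forall y, {within A, continuous (q ^~ y)}) -> bnd u ->
  lsc_on A (fun a => expect (q a) u).
Proof.
move=> pq cq bu a t Aa tu; have [B uB] := bu.
have B0 y : 0 <= u y + B.
  by have := uB y; rewrite ler_norml => /andP[h _]; rewrite -lerBlDr sub0r.
have bB := bnd_cst B : bnd (fun _ : X => B).
have bw := bndD bu bB.
have E a' : A a' -> expect (q a') (fun y => u y + B) = expect (q a') u + B.
  by move=> Aa'; rewrite expectD ?expect_cst//; exact: pq.
have pos a' y : A a' -> 0 <= q a' y * (u y + B).
  by move=> Aa'; rewrite mulr_ge0//; case: (pq _ Aa').
have [F tF] : exists F : {fset X}, t + B < \sum_(y <- F) q a y * (u y + B).
  apply: lt_rsum_finite => [y||]; [exact: pos|exact/expect_rsummable/bw/pq|].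
  by rewrite -/(expect _ _) E// ltrD2r.
have cF : \sum_(y <- F) q a' y * (u y + B) @[a' --> within A (nbhs a)] -->
          \sum_(y <- F) q a y * (u y + B).
  elim: {tF} (enum_fset F) => [|y s IH].
    by under eq_fun do rewrite big_nil; rewrite big_nil; exact: cvg_cst.
  under eq_fun do rewrite big_cons; rewrite big_cons.
  apply: cvgD IH.
  by apply: cvgMr_tmp; rewrite nbhs_subspace_in//; exact: cq.
have nA := near_withinT A (nbhs_filter a).
apply: filterS2 nA (cvgr_gt _ cF _ tF) => a' Aa' lt.
rewrite -(ltrD2r B) -E//; apply: lt_le_trans lt _.
apply: sum_le_rsum => [y|]; [exact: pos|exact/expect_rsummable/bw/pq].
Qed.

End LowerSemicontinuity.

(** * The discounted Bellman equation *)

Section Bellman.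
Context {R : realType} {Y : choiceType} {Act : Type}.
Variables (D : Y -> set Act) (c : Y -> Act -> R) (p : Y -> Act -> Y -> R).
Variables (b C : R).
Hypothesis b01 : 0 <= b < 1.
Hypothesis prob_p : forall y a, D y a -> prob (p y a).
Hypothesis c_le : forall y a, D y a -> `|c y a| <= C.
Hypothesis D_neq0 : forall y, D y !=set0.

(** Keeps the topology of the action sets out of the Bellman equation; compactness and lower
    semicontinuity supply it later. *)
Hypothesis min_attained : forall u y, bnd u ->
  exists2 a, D y a & forall a', D y a' ->
    c y a + b * expect (p y a) u <= c y a' + b * expect (p y a') u.

Let G (u : Y -> R) y a : R := c y a + b * expect (p y a) u.

Let b0 : 0 <= b. Proof. by case/andP: b01. Qed.
Let b1 : b < 1. Proof. by case/andP: b01. Qed.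

Let le_G u v y a : D y a -> bnd u -> bnd v -> (forall x, u x <= v x) ->
  G u y a <= G v y a.
Proof.
by move=> Da bu bv uv; rewrite lerD2l ler_wpM2l// le_expect//; exact: prob_p.
Qed.

(** The sum of the geometric series of [C * b ^+ n], i.e. the fixed point of t = C + b t: the ball
    of radius [B] is mapped into itself by [G]. *)
Let B := C / (1 - b).

Let BE : C + b * B = B.
Proof. by rewrite /B; field; rewrite gt_eqF// subr_gt0. Qed.

Let norm_G_le u y a : D y a -> (forall x, `|u x| <= B) -> `|G u y a| <= B.
Proof.
move=> Da uB; rewrite (le_trans (ler_normD _ _))// -BE lerD ?c_le//.
by rewrite normrM (ger0_norm b0) ler_wpM2l// norm_expect_le//; exact: prob_p.
Qed.

(** The solution is the pointwise supremum of the bounded subsolutions, as in the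
    Knaster-Tarski theorem; it is a solution because the operator preserves
    bounded subsolutions. *)
Lemma bellman_solution : exists u, [/\ bnd u,
  forall y a, D y a -> u y <= c y a + b * expect (p y a) u &
  forall y, exists2 a, D y a & u y = c y a + b * expect (p y a) u].
Proof.
pose U := [set u : Y -> R | (forall y, `|u y| <= B) /\
                            forall y a, D y a -> u y <= G u y a].
pose us y := sup [set u y | u in U].
(* [Y] may be empty, so the sign of [C] is obtained from a given state. *)
have C0 (y : Y) : 0 <= C by have [a Da] := D_neq0 y; exact: le_trans (normr_ge0 _) (c_le Da).
have BE0 (y : Y) : 0 <= B by rewrite divr_ge0 ?(C0 y)// subr_ge0 ltW.
have UB : U (fun=> - B).
  split=> [y|y a Da]; first by rewrite normrN ger0_norm// (BE0 y).
  have : `|G (fun=> - B) y a| <= B.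
    by apply: norm_G_le => // x; rewrite normrN ger0_norm// (BE0 y).
  by rewrite ler_norml => /andP[].
have Us y : has_sup [set u y | u in U].
  split; first by exists (- B), (fun=> - B).
  by exists B => _ [u [uB _] <-]; exact: le_trans (ler_norm _) (uB y).
have leUs u : U u -> forall y, u y <= us y.
  by move=> Uu y; apply: (sup_upper_bound (Us y)); exists u.
have usB y : `|us y| <= B.
  rewrite ler_norml (leUs _ UB)/=; apply: ge_sup; first by case: (Us y).
  by move=> _ [u [uB _] <-]; exact: le_trans (ler_norm _) (uB y).
have bus : bnd us by exists B.
have usG y a : D y a -> us y <= G us y a.
  move=> Da; apply: ge_sup; first by case: (Us y).
  move=> _ [u Uu <-]; have [uB uG] := Uu.
  apply: le_trans (uG _ _ Da) (le_G Da _ bus (leUs _ Uu)).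
  by exists B.
exists us; split => // y.
have /choice[m mP] y' : exists a, D y' a /\
    forall a', D y' a' -> G us y' a <= G us y' a'.
  by have [a] := min_attained y' bus; exists a.
exists (m y); first by case: (mP y).
apply/eqP; rewrite eq_le usG; last by case: (mP y).
(* The improved function [ut] is again in [U]: [us <= ut], so [G us <= G ut] by monotonicity. Hence
   [ut <= us], the missing inequality. *)
pose ut y := G us y (m y).
have utB x : `|ut x| <= B by apply: norm_G_le => //; case: (mP x).
apply: (leUs ut); split=> // x a Da.
apply: (le_trans ((mP x).2 _ Da)); apply: le_G => //; first by exists B.
by move=> z; apply: usG; case: (mP z).
Qed.

End Bellman.

(** * The HV-AG transformation *)

Lemma hvag_rate_None {R : realType} {X : countType} {S : Type}
    (M : mdp R X S) (l : X) (mu : X -> R) (b : R) :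
  hvag_rate M l mu b None None = pdelta None.
Proof. by apply/funext => y; rewrite /pdelta eq_sym. Qed.

Section Transformation.
Context {R : realType} {X : countType} {S : Type}.
Variables (M : mdp R X S) (l : X) (mu : X -> R) (b K : R).
Hypothesis prob_rate : forall x a, actions M x a -> prob (rate M x a).
Hypothesis mu_ge1 : forall x, 1 <= mu x.
Hypothesis mu_le : forall x, mu x <= K.
Hypothesis mu_drift : forall x a, actions M x a ->
  (1 + \esum_(y in [set~ l]) (rate M x a y * mu y)%:E <= (mu x)%:E)%E.
Hypothesis b_ge : (K - 1) / K <= b.

(** Zero at [l], so that sums over the complement of [l] become expectations of a bounded function
    on all of [X]. *)
Definition mu_taboo y : R := if y == l then 0 else mu y.

Definition bias (g : option X -> R) y : R :=
  mu y * (g (Some y) - g (Some l)).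

Local Notation nu := mu_taboo.

Let mu_gt0 x : 0 < mu x. Proof. exact: lt_le_trans (mu_ge1 x). Qed.

Let bnd_mu : bnd mu.
Proof. by exists K => x; rewrite ger0_norm// ltW. Qed.

Let nu_ge0 y : 0 <= nu y.
Proof. by rewrite /mu_taboo; case: ifP => // _; exact: ltW. Qed.

Let bnd_nu : bnd nu.
Proof.
exists K => y; rewrite ger0_norm// /mu_taboo; case: ifP => // _.
by rewrite (le_trans _ (mu_le l))// ltW.
Qed.

Let bK : 1 - b <= K^-1.
Proof.
have K0 : 0 < K by exact: lt_le_trans (mu_gt0 l) (mu_le l).
by have := b_ge; rewrite mulrBl mulfV ?gt_eqF// mul1r; lra.
Qed.

Let b_ge0 : 0 <= b.
Proof.
apply: le_trans b_ge; rewrite divr_ge0// ?subr_ge0.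
  exact: le_trans (mu_ge1 l) (mu_le l).
exact: le_trans (ltW (mu_gt0 l)) (mu_le l).
Qed.

(** Makes the probability of jumping to the added state nonnegative; at [b = 0] it forces [mu] to be
    1. *)
Let mu1_le x : mu x - 1 <= b * mu x.
Proof.
have : (1 - b) * mu x <= 1.
  rewrite -ler_pdivlMr// mul1r (le_trans bK)// lef_pV2 ?posrE//.
  exact: lt_le_trans (mu_le x).
lra.
Qed.

Lemma esum_taboo x a : actions M x a ->
  \esum_(z in [set~ l]) (rate M x a z * mu z)%:E = (expect (rate M x a) nu)%:E.
Proof.
move=> xa; have [q0 _] := prob_rate xa.
rewrite -ge0_rsumE; last 2 first.
- by move=> z; rewrite mulr_ge0.
- exact/expect_rsummable/bnd_nu/prob_rate.
rewrite esum_mkcond; apply: eq_esum => z _; rewrite /mu_taboo.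
case: eqP => [->|zl]; last by rewrite mem_set.
by rewrite memNset ?mulr0//; exact.
Qed.

Let drift x a : actions M x a -> 1 + expect (rate M x a) nu <= mu x.
Proof. by move=> xa; have := mu_drift xa; rewrite esum_taboo// -EFinD lee_fin. Qed.

Lemma bnd_Some (g : option X -> R) : bnd g -> bnd (g \o Some).
Proof. by move=> [B gB]; exists B => x; exact: gB. Qed.

Lemma bnd_bias g : bnd g -> bnd (bias g).
Proof.
move=> bg; apply: bndM => //; apply: bndB; first exact: (bnd_Some bg).
exact: bnd_cst.
Qed.

(** The entry at [l] is a remainder; collecting the multiples of [g (Some l)] turns [nu * g] into
    [bias g]. The factor [(b * mu x)^-1] is never cancelled, so [b = 0] is covered. *)
Let hvag_mass x a g : actions M x a -> bnd g ->
  rsummable (fun y => hvag_rate M l mu b (Some x) (Some a) y * g y) /\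
  expect (hvag_rate M l mu b (Some x) (Some a)) g =
  (1 - (b * mu x)^-1 * (mu x - 1)) * g None +
  (b * mu x)^-1 * (expect (rate M x a) (bias g) + (mu x - 1) * g (Some l)).
Proof.
move=> xa bg; have pq := prob_rate xa; set r := (b * mu x)^-1.
pose F y := r * (rate M x a y * (nu y * g (Some y))) + (if y == l then
  r * ((mu x - 1 - expect (rate M x a) nu) * g (Some l)) else 0).
have FE : (fun y => hvag_rate M l mu b (Some x) (Some a) y * g y) \o Some = F.
  apply/funext => y; rewrite /F /= /mu_taboo esum_taboo//=.
  by case: eqP => [->|_]; rewrite -/r; ring.
have bng : bnd (fun y => nu y * g (Some y)) by apply: bndM => //; exact: bnd_Some.
have s1 : rsummable (fun y => r * (rate M x a y * (nu y * g (Some y)))).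
  exact/rsummableZ/expect_rsummable.
have sF : rsummable F by apply: rsummableD => //; exact: rsummable_delta.
split; first by apply: rsummable_option; rewrite FE.
rewrite /expect rsum_option FE//=; congr (_ + _).
rewrite rsumD//; last exact: rsummable_delta.
rewrite rsum_delta rsumZ; last exact: expect_rsummable.
rewrite -/(expect (rate M x a) _) -mulrDr; congr (_ * _).
have -> : bias g = (fun y => nu y * g (Some y) - g (Some l) * nu y).
  apply/funext => y; rewrite /bias /mu_taboo; case: eqP => [->|_]; ring.
rewrite -/(expect _ _) expectB//; last exact: bndZ.
rewrite expectZ//; ring.
Qed.

Lemma hvag_expect x a g : actions M x a -> bnd g ->
  expect (hvag_rate M l mu b (Some x) (Some a)) g =
  (1 - (b * mu x)^-1 * (mu x - 1)) * g None +
  (b * mu x)^-1 * (expect (rate M x a) (bias g) + (mu x - 1) * g (Some l)).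
Proof. by move=> xa bg; case: (hvag_mass xa bg). Qed.

(** The total mass is the preceding formula for the constant function 1, whose bias vanishes.
    Nonnegativity at [l] is the drift condition. *)
Lemma hvag_prob x a : actions M x a ->
  prob (hvag_rate M l mu b (Some x) (Some a)).
Proof.
move=> xa; have r0 : 0 <= (b * mu x)^-1.
  by rewrite invr_ge0 mulr_ge0// ltW.
have p0 y : 0 <= hvag_rate M l mu b (Some x) (Some a) y.
  case: y => [y|] /=.
    rewrite esum_taboo//=; have := drift xa.
    case: ifP => _ ?; rewrite mulr_ge0//; first by lra.
    by rewrite mulr_ge0// ?(ltW (mu_gt0 y))//; case: (prob_rate xa).
  rewrite subr_ge0; have := b_ge0; rewrite le_eqVlt => /predU1P[<-|bp].
    by rewrite mul0r invr0 mul0r.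
  by rewrite mulrC ler_pdivrMr ?mulr_gt0// mul1r.
split=> //; have [] := hvag_mass xa (bnd_cst 1).
have -> : bias (fun=> 1) = (fun=> 0).
  by apply/funext => y; rewrite /bias subrr mulr0.
rewrite (expect_cst 0 (prob_rate xa)).
rewrite /expect (_ : (fun y => _) = hvag_rate M l mu b (Some x) (Some a)).
  by move=> s E; rewrite ge0_rsumE// E add0r !mulr1 subrK.
by apply/funext => y; rewrite mulr1.
Qed.

Lemma hvag_bellman x a g : actions M x a -> bnd g -> g None = 0 ->
  mu x * (hvag_cost M mu (Some x) (Some a) +
          b * expect (hvag_rate M l mu b (Some x) (Some a)) g) =
  cost M x a + expect (rate M x a) (bias g) + (mu x - 1) * g (Some l).
Proof.
move=> xa bg g0; rewrite hvag_expect// g0 mulr0 add0r /=.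
rewrite mulrDr mulVKf ?gt_eqF// -addrA; congr (_ + _).
have := b_ge0; rewrite le_eqVlt => /predU1P[b00|bp]; last first.
  by field; rewrite !gt_eqF.
have mu1 y : mu y = 1.
  by apply/eqP; rewrite eq_le mu_ge1 andbT; have := mu1_le y; rewrite -b00; lra.
(* When [b = 0] the weights [mu] are 1 and the drift condition leaves no mass
   off [l], so that the bias term vanishes too. *)
rewrite -b00 mul0r mulr0 mu1 subrr mul0r addr0.
have : expect (rate M x a) nu <= 0 by have := drift xa; rewrite mu1; lra.
move=> nu0; have pq := prob_rate xa; have [B gB] := bg.
have bB : bnd (fun y => 2 * B * nu y) by exact: bndZ.
have nE : expect (rate M x a) nu = 0.
  apply/eqP; rewrite eq_le nu0/= -[leLHS](expect_cst 0 pq).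
  by apply: le_expect => //; exact: bnd_cst.
have bE : bias g = (fun y => nu y * (g (Some y) - g (Some l))).
  by apply/funext => y; rewrite /bias /mu_taboo; case: eqP => [->|//]; rewrite subrr !mulr0.
(* Thus [bias g] lies between plus and minus [2 * B * nu], whose expectation is zero. *)
have le2 y : `|g (Some y) - g (Some l)| <= 2 * B.
  by rewrite (le_trans (ler_normB _ _))// mulr_natl mulr2n lerD.
apply/eqP; rewrite eq_le; apply/andP; split.
  rewrite -(mulr0 (- (2 * B))) -nE -expectZ//; apply: le_expect => //.
  - exact: bndZ.
  - exact: bnd_bias.
  move=> y; rewrite bE mulrC ler_wpM2l//.
  by have := le2 y; rewrite ler_norml => /andP[].
rewrite -(mulr0 (2 * B)) -nE -expectZ//; apply: le_expect => //.
  exact: bnd_bias.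
move=> y; rewrite bE mulrC ler_wpM2r//.
by have := le2 y; rewrite ler_norml => /andP[].
Qed.

End Transformation.

(** * The optimality equation and average-cost optimal policies *)

Theorem theorem16 (R : realType) (X : countType) (S : completeMetricType R)
    (A : set S) (M : mdp R X S) (l : X) (K : R) (mu : X -> R) (b : R) :
  separable S ->
  countable_state_mdp A M ->
  transition_probabilities M ->
  compactness_conditions M ->
  bounded_cost M ->
  (forall phi, policy M phi ->
     (imx_norm (imx_geometric (imx_taboo l (rate_mx M phi))) <= K%:E)%E) ->
  (forall x, 1 <= mu x) ->
  (forall x, mu x <= K) ->
  (forall x a, actions M x a ->
     (1 + \esum_(y in [set~ l]) (rate M x a y * mu y)%:E <= (mu x)%:E)%E) ->
  (K - 1) / K <= b -> b < 1 ->
  let v := hvag_value M l mu b in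
  let w := v (Some l) in
  let h := fun x : X => ((mu x)%:E * (v (Some x) - v (Some l)))%E in
  let rhs := fun (x : X) (a : S) =>
    ((cost M x a)%:E + csum (fun y : X => (rate M x a y)%:E * h y))%E in
  let Aav := fun x : X => [set a | actions M x a /\ (w + h x)%E = rhs x a] in
  [/\ forall x, v x \is a fin_num,
      forall x, let E := [set rhs x a | a in actions M x] in
        E (w + h x)%E /\ lbound E (w + h x)%E,
      forall x, optimal_average_cost M x = w &
      [/\ exists2 phi, policy M phi & forall x, Aav x (phi x),
          forall x, Aav x = [set a | actions M x a /\
            v (Some x) = ((hvag_cost M mu (Some x) (Some a))%:E + b%:E *
              csum (fun y : option X =>
                (hvag_rate M l mu b (Some x) (Some a) y)%:E * v y))%E] &
          forall phi, policy M phi -> (forall x, Aav x (phi x)) ->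
            average_cost_optimal M phi]].
Proof.
move=> _ [_ acts _ rates _] tp [cptA lscc cont_q _] [C cC] _ mu1 muK drift bge blt1.
have pq x a : actions M x a -> prob (rate M x a).
  by move=> xa; split; [move=> y; exact: (rates x y).1|exact: tp].
have mu0 x : 0 < mu x by exact: lt_le_trans (mu1 x).
have b01 : 0 <= b < 1.
  rewrite blt1 andbT; apply: le_trans bge; rewrite divr_ge0// ?subr_ge0.
    exact: le_trans (mu1 l) (muK l).
  exact: le_trans (ltW (mu0 l)) (muK l).
have [b0 _] := andP b01.
have act0 x : actions M x !=set0 by case: (acts x).
have C0 : 0 <= C.
  by have [a la] := act0 l; exact: le_trans (normr_ge0 _) (cC _ _ la).
have hp := fun x a => @hvag_prob _ _ _ M l mu b K pq mu1 muK drift bge x a.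
pose D := hvag_actions M.
pose c' := hvag_cost M mu.
pose p' := hvag_rate M l mu b.
have D0 y : D y !=set0.
  case: y => [x|]; last by exists None.
  by have [a xa] := act0 x; exists (Some a), a.
have pp y a : D y a -> prob (p' y a).
  case: y => [x [a' xa <-]|->]; first exact: hp.
  by rewrite /p' hvag_rate_None; exact: prob_delta.
have c'C y a : D y a -> `|c' y a| <= C.
  case: y => [x [a' xa <-]|->]; rewrite /c' /= ?normr0//.
  rewrite normrM normfV (gtr0_norm (mu0 x)) mulrC ler_pdivrMr//.
  by rewrite (le_trans (cC _ _ xa))// ler_peMr.
have mina u y : bnd u -> exists2 a, D y a & forall a', D y a' ->
    c' y a + b * expect (p' y a) u <= c' y a' + b * expect (p' y a') u.
  move=> bu; case: y => [x|]; last by exists None => // a' ->.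
  have bh := bnd_bias l mu1 muK bu.
  (* By [hvag_expect] the objective is a nonnegative combination of the cost and an expectation
     under the original rates, plus a term free of [a]. Lower semicontinuity thus follows without
     examining the transformed rates, whose entry at [l] hides an infinite sum. *)
  pose f a := (mu x)^-1 * cost M x a + (b * (b * mu x)^-1 *
    expect (rate M x a) (bias l mu u) +
    b * ((1 - (b * mu x)^-1 * (mu x - 1)) * u None +
         (b * mu x)^-1 * ((mu x - 1) * u (Some l)))).
  have fE a : actions M x a ->
      c' (Some x) (Some a) + b * expect (p' (Some x) (Some a)) u = f a.
    move=> xa; rewrite /p' (hvag_expect l b pq mu1 muK xa bu) /f /c' /=; ring.
  have [a xa fa] : exists2 a, actions M x a &
      forall a', actions M x a' -> f a <= f a'.
    apply: compact_lsc_min => //.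
    apply: lsc_onD; last apply: lsc_onD; last exact: lsc_on_cst.
      apply: lsc_onZ; first by rewrite invr_ge0 ltW.
      exact: lower_semicontinuous_lsc_on.
    apply: lsc_onZ; first by rewrite mulr_ge0// invr_ge0 mulr_ge0// ltW.
    by apply: lsc_on_expect => //; exact: pq.
  exists (Some a); first by exists a.
  by move=> _ [a' xa' <-]; rewrite !fE//; exact: fa.
have [u [bu uG uGeq]] := bellman_solution b01 pp c'C D0 mina.
(* The added state is absorbing and costs nothing, so [u None = b * u None] with [b < 1]. *)
have u0 : u None = 0.
  have [a ->] := uGeq None; rewrite /c' /p' add0r hvag_rate_None expect_delta.
  move=> uE; apply/eqP.
  have : (1 - b) * u None = 0 by rewrite mulrBl mul1r -uE subrr.
  by move=> /eqP; rewrite mulf_eq0 subr_eq0 gt_eqF.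
have /choice[phi0 phi0P] (x : X) : exists a, actions M x a /\
    u (Some x) = c' (Some x) (Some a) + b * expect (p' (Some x) (Some a)) u.
  by have [_ [a xa <-] uE] := uGeq (Some x); exists a.
have pol0 : policy M phi0 by move=> x; case: (phi0P x).
have Dphi phi y : policy M phi -> D y (hvag_policy phi y).
  by move=> pphi; case: y => [x|//]; exists (phi x).
have vE : hvag_value M l mu b = (fun y => (u y)%:E).
  apply/funext => y; apply/eqP; rewrite eq_le; apply/andP; split.
    apply: ereal_inf_lbound; exists phi0 => //.
    apply: (@discounted_unique R (option X) b
      (fun y => p' y (hvag_policy phi0 y)) u (fun y => c' y (hvag_policy phi0 y))) => //.
    - by move=> z; apply: pp; exact: Dphi.
    - by exists C => z; apply: c'C; exact: Dphi.
    - case=> [x|]; first by case: (phi0P x).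
      by have [_ -> ->] := uGeq None.
  apply: le_ereal_inf_tmp => _ [phi pphi <-].
  apply: (@le_discounted R (option X) b
    (fun y => p' y (hvag_policy phi y)) u (fun y => c' y (hvag_policy phi y))) => //.
  - by move=> z; apply: pp; exact: Dphi.
  - by exists C => z; apply: c'C; exact: Dphi.
  - by move=> z; apply: uG; exact: Dphi.
move=> v w h rhs Aav.
have vu : v = (fun y => (u y)%:E) by [].
pose hr := bias l mu u.
have bhr : bnd hr := bnd_bias l mu1 muK bu.
have hE x : h x = (hr x)%:E by rewrite /h vu -EFinB -EFinM.
have rhsE x a : actions M x a ->
    rhs x a = (cost M x a + expect (rate M x a) hr)%:E.
  move=> xa; rewrite EFinD -csum_expect//; last exact: pq.
  by rewrite /rhs; congr (_ + csum _)%E; apply/funext => y; rewrite hE.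
(* The defects of the two optimality equations differ by the positive factor [mu x]: they vanish for
   the same actions and have the same sign. *)
have key x a : actions M x a ->
    cost M x a + expect (rate M x a) hr - (u (Some l) + hr x) =
    mu x * (c' (Some x) (Some a) + b * expect (p' (Some x) (Some a)) u - u (Some x)).
  move=> xa; rewrite mulrBr (hvag_bellman pq mu1 muK drift bge xa bu u0) /hr /bias.
  by rewrite -/(bias l mu u); ring.
have whE x : (w + h x)%E = (u (Some l) + hr x)%:E by rewrite hE /w vu EFinD.
have AavE x : Aav x = [set a | actions M x a /\
    u (Some x) = c' (Some x) (Some a) + b * expect (p' (Some x) (Some a)) u].
  apply/seteqP; split => a [xa E]; split=> //.
    move: E; rewrite whE rhsE// => -[E]; have /esym/eqP := key x a xa.
    by rewrite E subrr mulf_eq0 gt_eqF//= subr_eq0 => /eqP.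
  rewrite whE rhsE//; congr EFin.
  by have := key x a xa; rewrite -E subrr mulr0 => /eqP; rewrite subr_eq0 => /eqP.
have polav phi : policy M phi -> (forall x, Aav x (phi x)) ->
    forall x, average_cost M phi x = w.
  move=> pphi aphi x; rewrite /w vu.
  apply: (@average_unique R X (fun y => rate M y (phi y)) hr
    (fun y => cost M y (phi y))) => //.
  - by move=> y; exact: pq.
  - by exists C => y; exact: cC.
  - move=> y; have [ya] := aphi y; rewrite whE rhsE//.
    by move=> [].
have aphi0 x : Aav x (phi0 x) by rewrite AavE; exact: phi0P.
have opt x : optimal_average_cost M x = w.
  apply/eqP; rewrite eq_le; apply/andP; split.
    by apply: ereal_inf_lbound; exists phi0 => //; exact: polav.
  apply: le_ereal_inf_tmp => _ [phi pphi <-]; rewrite /w vu.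
  apply: (@le_average R X (fun y => rate M y (phi y)) hr
    (fun y => cost M y (phi y))) => //.
  - by move=> y; exact: pq.
  - by exists C => y; exact: cC.
  (* Through [key], the Bellman inequality for [u] becomes the average-cost inequality along an
     arbitrary policy. *)
  - move=> y; rewrite -subr_ge0 key// mulr_ge0 ?(ltW (mu0 y))// subr_ge0.
    by apply: uG; exists (phi y).
split.
- by move=> x; rewrite vu.
- move=> x; split.
    by exists (phi0 x); [exact: pol0|have [_ ->] := aphi0 x].
  move=> _ [a xa <-]; rewrite whE rhsE// lee_fin -subr_ge0 key//.
  by rewrite mulr_ge0 ?(ltW (mu0 x))// subr_ge0; apply: uG; exists a.
- exact: opt.
- split.
  + by exists phi0.
  + move=> x; rewrite AavE; apply/seteqP; split => a /= [xa E]; split=> //.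
      rewrite vu csum_expect//; last exact: hp.
      by rewrite -EFinM -EFinD E.
    move: E; rewrite vu csum_expect//; last exact: hp.
    by rewrite -EFinM -EFinD => -[].
  + by move=> phi pphi aphi; split=> // x; rewrite opt polav.
Qed.
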